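(* Let $N\in\mathbb{N}$ and let $X, Y\in\{0,1\}^N$ be random vectors. Write $$\mathbb{P}(X=x)=\frac{1}{\kappa}\exp\{L(x)\},\qquad x\in\{0,1\}^N,$$ for a function $L$ on $\{0,1\}^N$ and a normalising constant $\kappa$, and assume that $Y$ has independent coordinates with $p_s:=\mathbb{P}(Y_s=1)$, for $s=1,\ldots,N$, satisfying $$p_s=\frac{1+\tanh\left(\frac12\,\mathbb{E}\,\Delta_s L(Y)\right)}{2}.$$ Assume that for each $s\in[N]$ and $x\in\{0,1\}^N$ there is a coupling $(\tilde U^{[x,s]},\tilde V^{[x,s]})$ with $\mathcal{L}(\tilde U^{[x,s]})=\mathcal{L}(X(1)\mid X(0)=x^{(s,1)})$ and $\mathcal{L}(\tilde V^{[x,s]})=\mathcal{L}(X(1)\mid X(0)=x^{(s,0)})$, where $(X(m))_{m\ge 0}$ is the (discrete time) Glauber dynamics of $\mathcal{L}(X)$, such that for some $0<\rho\le 1$ (not depending on $s,x$), $$\mathbb{E}\, d_{\mathrm H}(\tilde U^{[x,s]},\tilde V^{[x,s]})\le 1-\rho,$$ and that the Glauber dynamics of $\mathcal{L}(X)$ are irreducible. Then for any $h:\{0,1\}^N\to\mathbb{R}$, $$\left|\mathbb{E}h(X)-\mathbb{E}h(Y)\right|\le \frac{\|\Delta h\|}{4N\rho}\sum_{s=1}^N\mathbb{E}\left|\Delta_sL(Y)-\mathbb{E}\,\Delta_sL(Y)\right|.$$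
   Context: $[N]=\{1,\dots,N\}$; $\mathcal{L}(W)$ denotes the law of $W$. For $x\in\{0,1\}^N$ and $s\in[N]$, $x^{(s,1)}$ (respectively $x^{(s,0)}$) denotes the vector equal to $x$ except that its $s$th coordinate is set to $1$ (respectively $0$). For $g:\{0,1\}^N\to\mathbb{R}$, $\Delta_s g(x):=g(x^{(s,1)})-g(x^{(s,0)})$; $\|\cdot\|$ is the supremum norm, and $\|\Delta g\|:=\sup_{s\in[N]}\|\Delta_s g\|$. Hamming distance: $d_{\mathrm H}(x,y):=\sum_{s=1}^N|x_s-y_s|$. Glauber dynamics of $\mathcal{L}(X)$: the discrete time Markov chain $(X(m))_{m=0,1,\dots}$ on $\{0,1\}^N$ which, at each step, from state $x$, chooses a coordinate $s\in[N]$ uniformly at random and moves to $x^{(s,1)}$ with probability $q_X(x^{(s,1)}|x)$ and to $x^{(s,0)}$ with probability $1-q_X(x^{(s,1)}|x)$, where $q_X(x^{(s,1)}|x):=\mathbb{P}(X_s=1\mid (X_u)_{u\ne s}=(x_u)_{u\ne s})$. *)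

(* Defs.v *)
From mathcomp Require Import all_boot all_order all_algebra.
From mathcomp Require Import all_classical all_reals all_analysis.

Set Implicit Arguments.
Unset Strict Implicit.
Unset Printing Implicit Defensive.

Import Order.TTheory GRing.Theory Num.Theory.
Import numFieldNormedType.Exports.

Local Open Scope classical_set_scope.
Local Open Scope ring_scope.

(* {0,1}^N, with the product sigma-algebra of n.-tuple; as bool is discrete,
   every subset is measurable. Coordinates are numbered from 0. *)
Notation cube N := (N.-tuple bool).

(* x^(s,b) *)
Definition set_coord (N : nat) (x : cube N) (s : 'I_N) (b : bool) : cube N :=
  [tuple if i == s then b else tnth x i | i < N].

Definition Delta (R : realType) (N : nat) (s : 'I_N) (g : cube N -> R)
    (x : cube N) : R :=
  g (set_coord x s true) - g (set_coord x s false).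

(* Maxima over finite types of nonnegative quantities: starting them at 0 does
   not change their value. *)
Definition sup_norm (R : realType) (N : nat) (g : cube N -> R) : R :=
  \big[Num.max/0]_(x : cube N) `|g x|.

Definition Delta_norm (R : realType) (N : nat) (g : cube N -> R) : R :=
  \big[Num.max/0]_(s < N) sup_norm (Delta s g).

Definition hamming (R : realType) (N : nat) (x y : cube N) : R :=
  \sum_(s < N) `|(tnth x s)%:R - (tnth y s)%:R|.

Definition tanh (R : realType) (t : R) : R :=
  (expR t - expR (- t)) / (expR t + expR (- t)).

(* Only used for bounded measurable f, whose expectation is finite. *)
Definition mean d (T : measurableType d) (R : realType) (P : probability T R)
    (f : T -> R) : R :=
  fine 'E_P[f].

Definition cond_prob d (T : measurableType d) (R : realType)
    (P : probability T R) (A B : set T) : R :=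
  fine (P (A `&` B)) / fine (P B).

Definition independent_coords d (T : measurableType d) (R : realType)
    (N : nat) (P : probability T R) (Y : {RV P >-> cube N}) : Prop :=
  forall (J : {set 'I_N}) (A : 'I_N -> set bool),
    P [set w | forall s, s \in J -> A s (tnth (Y w) s)] =
    (\prod_(s in J) P [set w | A s (tnth (Y w) s)])%E.

(* The law of the random vector U is given by the probability mass function p *)
Definition has_law d (T : measurableType d) (R : realType)
    (N : nat) (P : probability T R) (U : {RV P >-> cube N})
    (p : cube N -> R) : Prop :=
  forall x, distribution P U [set x] = (p x)%:E.

Section glauber.
Context d (T : measurableType d) (R : realType) (N : nat)
  (P : probability T R) (X : {RV P >-> cube N}).

(* q_X(x^(s,1) | x) *)
Definition glauber_q (x : cube N) (s : 'I_N) : R :=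
  cond_prob P [set w | tnth (X w) s = true]
              [set w | forall u, u != s -> tnth (X w) u = tnth x u].

(* Transition matrix of the Glauber dynamics of the law of X:
   [glauber x] is the mass function of the law of X(1) given X(0) = x. *)
Definition glauber (x y : cube N) : R :=
  \sum_(s < N) N%:R^-1 *
    (glauber_q x s * (y == set_coord x s true)%:R +
     (1 - glauber_q x s) * (y == set_coord x s false)%:R).

End glauber.

(* m-step transition probabilities *)
Fixpoint nstep (R : realType) (S : finType) (K : S -> S -> R) (m : nat)
    (x y : S) : R :=
  if m is m'.+1 then \sum_(z : S) K x z * nstep K m' z y else (x == y)%:R.

Definition irreducible_chain (R : realType) (S : finType)
    (K : S -> S -> R) : Prop :=
  forall x y, exists m, 0 < nstep K m x y.

(* (U, V) on a common probability space: laws p and q and mean Hamming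
   distance at most r *)
Definition coupling_within (R : realType) (N : nat) (p q : cube N -> R)
    (r : R) : Prop :=
  exists (d : measure_display) (T : measurableType d) (P : probability T R)
         (U V : {RV P >-> cube N}),
    [/\ has_law U p, has_law V q &
        mean P (fun w => hamming R (U w) (V w)) <= r].

(* Main.v *)
Require Import Defs.
From mathcomp Require Import all_boot all_order all_algebra.
From mathcomp Require Import all_classical all_reals all_analysis.
From mathcomp Require Import ring.

Set Implicit Arguments.
Unset Strict Implicit.
Unset Printing Implicit Defensive.

Import Order.TTheory GRing.Theory Num.Theory.
Import numFieldNormedType.Exports.

Local Open Scope classical_set_scope.
Local Open Scope ring_scope.

(** Stein's method through the Glauber dynamics. Let [K] be the transition
    operator of the dynamics of [X]. The one-step coupling makes [K] a contraction
    of the seminorm [Delta_norm], with ratio [1 - rho], and the law of [X] is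
    stationary. Resampling coordinate [s] of [Y] with probability [p s] preserves
    the law of [Y], so [E (K h)(Y) - E h(Y)] is an average over [s] of
    [E ((q s - p s) * Delta s h)(Y)]; here [q s] and [p s] are values of one
    1/4-Lipschitz logistic function, at [Delta s L(Y)] and at its mean. Hence
    [D h := |E h(X) - E h(Y)|] satisfies [D h <= D (K h) + B * Delta_norm h],
    and iterating this inequality sums a geometric series of ratio [1 - rho].
    Bounding [D] after [n] steps avoids solving the Stein equation. *)

(** * Means and measurability for finitely valued maps *)

Section finite_valued.
Context d (T : measurableType d) (R : realType) (P : probability T R).

(** [F (Z w)] is a finite sum of scaled indicators of the fibres of [Z]. Only measurable fibres are
    assumed of [Z], so that the lemma also covers the pair formed by a coupling. *)
Lemma mean_finite (S : finType) (Z : T -> S) (F : S -> R) :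
  (forall z, measurable (Z @^-1` [set z])) ->
  mean P (fun w => F (Z w)) = \sum_(z : S) F z * fine (P (Z @^-1` [set z])).
Proof.
move=> mZ; rewrite /mean unlock.
pose f z w : \bar R := ((F z)%:E * (\1_(Z @^-1` [set z]) w)%:E)%E.
have intf z : P.-integrable setT (f z).
  apply: integrableZl => //.
  by apply: integrable_indic.
transitivity (fine (\int[P]_w (\sum_(z : S) f z w))%E).
  congr fine; apply: eq_integral => w _.
  rewrite (bigD1 (Z w)) //= /f indicE mem_set // mule1 big1 ?adde0 // => z nz.
  by rewrite indicE memNset ?mule0 // => /= e; rewrite e eqxx in nz.
rewrite integral_sum //.
under eq_bigr => z _.
  rewrite integralZl //=; last exact: integrable_indic.
  rewrite integral_indic // setIT.
  rewrite -[X in (_ * X)%E]fineK ?fin_num_measure // -EFinM.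
  over.
by rewrite sumEFin.
Qed.

(** A singleton of the cube is a finite intersection of coordinate cylinders, and every subset is a
    finite union of singletons. *)
Lemma measurable_preimage_cube N (X : {RV P >-> cube N}) (A : set (cube N)) :
  measurable (X @^-1` A).
Proof.
suff h x : measurable (X @^-1` [set x]).
  have -> : X @^-1` A = \big[setU/set0]_(x : cube N | x \in A) (X @^-1` [set x]).
    apply/seteqP; split=> w /=.
      move=> Aw; rewrite -bigcup_seq_cond; exists (X w) => //=.
      by rewrite mem_index_enum mem_set.
    rewrite -bigcup_seq_cond => -[x /= /andP[_ /set_mem Ax] e].
    by move: Ax; rewrite -e.
  by apply: bigsetU_measurable.
have -> : X @^-1` [set x] =
    \big[setI/setT]_(s < N) (X @^-1` ((fun y : cube N => tnth y s) @^-1` [set tnth x s])).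
  apply/seteqP; split=> w /=.
    by move=> <-; rewrite -bigcap_seq => s.
  rewrite -bigcap_seq => h; apply: eq_from_tnth => s.
  by apply: h; rewrite /= mem_index_enum.
apply: bigsetI_measurable => s _.
rewrite -[_ @^-1` _]setTI; apply: (measurable_funPT X) => //.
by rewrite -[_ @^-1` _]setTI; apply: measurable_tnth.
Qed.

End finite_valued.

(** * Discrete calculus on the cube *)

Section cube_calculus.
Context (R : realType) (N : nat).
Implicit Types (g : cube N -> R) (x y : cube N) (s : 'I_N).

Lemma tnth_set_coord x s b i :
  tnth (set_coord x s b) i = if i == s then b else tnth x i.
Proof. by rewrite tnth_mktuple. Qed.

Lemma set_coordK x s b c : set_coord (set_coord x s b) s c = set_coord x s c.
Proof.
by apply: eq_from_tnth => i; rewrite !tnth_set_coord; case: eqP.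
Qed.

Lemma set_coord_id x s : set_coord x s (tnth x s) = x.
Proof.
by apply: eq_from_tnth => i; rewrite tnth_set_coord; case: eqP => // ->.
Qed.

Lemma Delta_norm_ge0 g : 0 <= Delta_norm g.
Proof. exact: bigmax_ge_id. Qed.

Lemma Delta_le_norm g s x : `|Delta s g x| <= Delta_norm g.
Proof.
apply: (@le_trans _ _ (sup_norm (Delta s g))).
  exact: (le_bigmax _ (fun x => `|Delta s g x|)).
exact: (le_bigmax _ (fun s => sup_norm (Delta s g))).
Qed.

Lemma Delta_norm_le g M : 0 <= M ->
  (forall s x, `|Delta s g x| <= M) -> Delta_norm g <= M.
Proof.
by move=> M0 gM; apply: bigmax_le => // s _; apply: bigmax_le => // x _.
Qed.

Lemma set_coord_lipschitz g x s a b :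
  `|g (set_coord x s a) - g (set_coord x s b)| <=
  Delta_norm g * `|a%:R - b%:R|.
Proof.
have := Delta_le_norm g s x; rewrite /Delta.
case: a b => [] [] /=; rewrite ?subrr ?normr0 ?mulr0 // ?subr0 ?sub0r ?normrN1 ?normr1 ?mulr1 //.
by rewrite distrC.
Qed.

Lemma hamming_lipschitz g x y :
  `|g x - g y| <= Delta_norm g * hamming R x y.
Proof.
(* The path from [x] to [y] that switches coordinates one at a time, in order; its increments
   telescope, and step [s] changes coordinate [s] only. *)
pose z k := [tuple if (i < k)%N then tnth y i else tnth x i | i < N].
have z0 : z 0%N = x by apply: eq_from_tnth => i; rewrite tnth_mktuple.
have zN : z N = y by apply: eq_from_tnth => i; rewrite tnth_mktuple ltn_ord.
have zl (s : 'I_N) : z s = set_coord (z s) s (tnth x s).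
  by rewrite -[LHS](set_coord_id _ s) tnth_mktuple ltnn.
have zr (s : 'I_N) : z s.+1 = set_coord (z s) s (tnth y s).
  apply: eq_from_tnth => i; rewrite tnth_set_coord !tnth_mktuple ltnS.
  by rewrite leq_eqVlt val_eqE; case: (i =P s) => [->|].
rewrite -[in g x]z0 -[in g y]zN distrC -(telescope_sumr (g \o z)) // big_mkord.
rewrite /hamming mulr_sumr (le_trans (ler_norm_sum _ _ _)) //.
apply: ler_sum => s _ /=.
rewrite [`|_%:R - _|]distrC zr [in X in - g X]zl; exact: set_coord_lipschitz.
Qed.

Lemma hamming_le x y : hamming R x y <= N%:R.
Proof.
apply: (@le_trans _ _ (\sum_(s < N) 1)); last by rewrite sumr_const card_ord.
by apply: ler_sum => s _; case: (tnth x s) (tnth y s) => [] [];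
  rewrite ?subrr ?normr0 ?subr0 ?sub0r ?normrN1 ?normr1.
Qed.

(** Flipping coordinate [s] pairs up the points of the cube; each pair is indexed by its member with
    a one at [s]. *)
Lemma sum_cube_coord s (F : cube N -> R) :
  \sum_x F x = \sum_(x : cube N | tnth x s)
    (F (set_coord x s true) + F (set_coord x s false)).
Proof.
rewrite big_split /= (bigID (fun x => tnth x s)) /=; congr (_ + _).
  by apply: eq_bigr => x xs; rewrite -[in LHS](set_coord_id x s) xs.
rewrite (reindex_onto (fun x => set_coord x s false) (fun x => set_coord x s true)) /=.
  apply: eq_bigl => x; rewrite tnth_set_coord eqxx /= set_coordK.
  case: eqP => [<-|]; first by rewrite tnth_set_coord eqxx.
  by case: (boolP (tnth x s)) => // xs; rewrite -[in X in X -> _](set_coord_id x s) xs set_coordK.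
by move=> x /negPf xs; rewrite set_coordK -[in RHS](set_coord_id x s) xs.
Qed.

(* If [q] is the conditional probability of a one at [s] under [u], resampling
   coordinate [s] preserves [u]. *)
Lemma sum_resample s (u q g : cube N -> R) :
  (forall x b, q (set_coord x s b) = q x) ->
  (forall x, q x * (u (set_coord x s true) + u (set_coord x s false)) =
             u (set_coord x s true)) ->
  \sum_x u x * (q x * g (set_coord x s true) +
                (1 - q x) * g (set_coord x s false)) = \sum_x u x * g x.
Proof.
move=> qs qu; rewrite [LHS](sum_cube_coord s) [RHS](sum_cube_coord s).
apply: eq_bigr => x _; rewrite !set_coordK !qs.
have := qu x; set u1 := u _; set u0 := u _; set g1 := g _; set g0 := g _.
(* Both weights are written through [q x * (u1 + u0)], which [e] replaces by [u1]; no division by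
   [u1 + u0] is made. *)
move=> e; transitivity (q x * (u1 + u0) * g1 + (u1 + u0 - q x * (u1 + u0)) * g0).
  by ring.
by rewrite e; ring.
Qed.

End cube_calculus.

(** * Probability mass functions of random vectors *)

Section laws.
Context d (T : measurableType d) (R : realType) (P : probability T R) (N : nat).

Definition mass (X : {RV P >-> cube N}) (x : cube N) : R :=
  fine (P (X @^-1` [set x])).

Lemma mean_mass (X : {RV P >-> cube N}) (f : cube N -> R) :
  mean P (fun w => f (X w)) = \sum_x mass X x * f x.
Proof.
rewrite mean_finite; last by move=> z; exact: measurable_preimage_cube.
by apply: eq_bigr => x _; rewrite mulrC.
Qed.

Lemma mass_law (X : {RV P >-> cube N}) (p : cube N -> R) :
  has_law X p -> mass X =1 p.
Proof. by move=> Xp x; have /(congr1 fine) := Xp x. Qed.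

Lemma mass_ge0 (X : {RV P >-> cube N}) x : 0 <= mass X x.
Proof. exact: fine_ge0. Qed.

Lemma mass_sum1 (X : {RV P >-> cube N}) : \sum_x mass X x = 1.
Proof.
have := mean_mass X (cst 1); rewrite /mean expectation_cst /= => ->.
by apply: eq_bigr => x _; rewrite mulr1.
Qed.

End laws.

(** * From couplings to differences of expectations *)

Section coupling.
Context (R : realType) (N : nat).

(** Under the joint law [mu] of the coupled pair, the difference of the two sums is the mean of
    [g U - g V], and [g] is Lipschitz for the Hamming distance with constant [Delta_norm g]. *)
Lemma coupling_contraction (p q g : cube N -> R) r :
  coupling_within p q r ->
  `|\sum_x p x * g x - \sum_x q x * g x| <= r * Delta_norm g.
Proof.
case=> d [T [P [U [V [Up Vq UVr]]]]].
pose Z w : cube N * cube N := (U w, V w).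
have mZ z : measurable (Z @^-1` [set z]).
  have -> : Z @^-1` [set z] = (U @^-1` [set z.1]) `&` (V @^-1` [set z.2]).
    by case: z => a b; apply/seteqP; split=> w /= [<- <-].
  by apply: measurableI; exact: measurable_preimage_cube.
pose mu z := fine (P (Z @^-1` [set z])).
have mean_mu (F : cube N -> cube N -> R) :
    mean P (fun w => F (U w) (V w)) = \sum_z F z.1 z.2 * mu z.
  exact: (mean_finite P (fun z => F z.1 z.2) mZ).
have -> : \sum_x p x * g x = \sum_z g z.1 * mu z.
  rewrite -(mean_mu (fun x _ => g x)) mean_mass.
  by apply: eq_bigr => x _; rewrite (mass_law Up).
have -> : \sum_x q x * g x = \sum_z g z.2 * mu z.
  rewrite -(mean_mu (fun _ x => g x)) mean_mass.
  by apply: eq_bigr => x _; rewrite (mass_law Vq).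
rewrite -sumrB (le_trans (ler_norm_sum _ _ _)) //.
rewrite (mean_mu (@hamming R N)) in UVr.
rewrite mulrC (le_trans _ (ler_wpM2l (Delta_norm_ge0 g) UVr)) // mulr_sumr.
apply: ler_sum => z _; have mu0 : 0 <= mu z by exact: fine_ge0.
by rewrite -mulrBl normrM (ger0_norm mu0) mulrA ler_wpM2r // hamming_lipschitz.
Qed.

End coupling.

(** * The logistic function *)

Section tanh.
Context (R : realType).

(** Turns the fixed-point equation for [p s] into the logistic form that [glauber_q] takes for a
    Gibbs law. *)
Lemma tanh_half (t : R) :
  (1 + tanh (2^-1 * t)) / 2 = (1 + expR (- t))^-1.
Proof.
(* With u = exp(t/2) and v = exp(-t/2) one has uv = 1 and exp(-t) = v * v, so the claim is a
   rational identity in v. *)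
rewrite /tanh; have -> : - t = - (2^-1 * t) + - (2^-1 * t) by field.
set a := 2^-1 * t; rewrite expRD.
have e1 : expR a * expR (- a) = 1 by rewrite -expRD subrr expR0.
have := expR_gt0 a; have := expR_gt0 (- a).
move: (expR a) (expR (- a)) e1 => u v uv v0 u0.
have : u + v != 0 by rewrite gt_eqF // addr_gt0.
have : 1 + v * v != 0 by rewrite gt_eqF // addr_gt0 // mulr_gt0.
have uE : u = v^-1 by apply: (mulIf (x := v)); rewrite ?gt_eqF // uv mulVf ?gt_eqF.
have v1 : v != 0 by rewrite gt_eqF.
rewrite uE => h1 h2; field.
by rewrite v1 h1.
Qed.

Lemma logistic_lipschitz (s t : R) :
  `|(1 + expR (- s))^-1 - (1 + expR (- t))^-1| <= `|s - t| / 4.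
Proof.
pose f (x : R) : R := (1 + expR (- x))^-1.
pose df (x : R) : R := expR (- x) / (1 + expR (- x)) ^+ 2.
have fd x : is_derive x (1 : R) f (df x).
  have n0 : 1 + expR (- x) != 0 by rewrite gt_eqF // addr_gt0 // expR_gt0.
  have h : is_derive x (1 : R) (fun y : R => 1 + expR (- y)) (- expR (- x)).
    by apply: is_derive_eq; rewrite /GRing.scale /=; ring.
  have hV := @is_deriveV R (fun y : R => 1 + expR (- y)) x _ 1 n0 h.
  apply: (is_derive_eq hV).
  by rewrite /df /GRing.scale /= mulrNN mulrC.
have df4 x : `|df x| <= 4^-1.
  rewrite /df; have := expR_gt0 (- x); move: (expR _) => v v0.
  rewrite ger0_norm; last by rewrite divr_ge0 ?sqr_ge0 // ltW.
  rewrite ler_pdivrMr ?exprn_gt0 ?addr_gt0 // -subr_ge0.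
  (* The constant 1/4 comes from 4v <= (1 + v)^2, with equality at v = 1, where the slope is
     largest. *)
  have -> : 4^-1 * (1 + v) ^+ 2 - v = 4^-1 * (1 - v) ^+ 2 by field.
  by rewrite mulr_ge0 ?sqr_ge0.
wlog: s t / t < s.
  move=> W; have [st|st|->] := ltgtP s t; last by rewrite !subrr normr0 mul0r.
    by rewrite distrC [`|s - t|]distrC; exact: W.
  exact: W.
move=> ts; have [|c _ e] := MVT ts (fun x _ => fd x).
  apply: derivable_within_continuous => x _; exact: ex_derive.
by rewrite -/(f s) -/(f t) e normrM mulrC ler_wpM2l.
Qed.

End tanh.

(** * Transition operator of the Glauber dynamics *)

Section glauber_dynamics.
Context d (T : measurableType d) (R : realType) (N : nat)
  (P : probability T R) (X : {RV P >-> cube N}).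
Implicit Types (g : cube N -> R) (x y : cube N) (s : 'I_N).

Definition glauber_op g x : R := \sum_y glauber X x y * g y.

Lemma glauber_opE g x : glauber_op g x =
  \sum_(s < N) N%:R^-1 * (glauber_q X x s * g (set_coord x s true) +
                          (1 - glauber_q X x s) * g (set_coord x s false)).
Proof.
have pick z : \sum_y (y == z)%:R * g y = g z.
  rewrite (bigD1 z) //= eqxx mul1r big1 ?addr0 // => y /negPf ->.
  by rewrite mul0r.
rewrite /glauber_op /glauber; under eq_bigr do rewrite mulr_suml.
rewrite exchange_big; apply: eq_bigr => s _ /=.
rewrite -[in RHS](pick (set_coord x s true)) -[in RHS](pick (set_coord x s false)).
rewrite !mulr_sumr -big_split /= mulr_sumr; apply: eq_bigr => y _; ring.
Qed.

(** Fixing all coordinates but [s] leaves two points, so the conditioning event is a disjoint union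
    of two fibres of [X]. *)
Lemma glauber_q_mass x s : glauber_q X x s =
  mass X (set_coord x s true) /
  (mass X (set_coord x s true) + mass X (set_coord x s false)).
Proof.
rewrite /glauber_q /cond_prob /mass.
have mX := measurable_preimage_cube X.
have -> : [set w | tnth (X w) s = true] `&`
    [set w | forall u, u != s -> tnth (X w) u = tnth x u] =
    X @^-1` [set set_coord x s true].
  apply/seteqP; split=> w /=.
    move=> [Xs Xu]; apply: eq_from_tnth => u; rewrite tnth_set_coord.
    by case: eqP => [->//|/eqP]; exact: Xu.
  move=> ->; split; first by rewrite tnth_set_coord eqxx.
  by move=> u /negPf us; rewrite tnth_set_coord us.
have -> : [set w | forall u, u != s -> tnth (X w) u = tnth x u] =
    X @^-1` [set set_coord x s true] `|` X @^-1` [set set_coord x s false].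
  apply/seteqP; split=> w /=.
    move=> Xu; suff : X w = set_coord x s (tnth (X w) s).
      by case: (tnth _ _); [left|right].
    apply: eq_from_tnth => u; rewrite tnth_set_coord.
    by case: eqP => [->//|/eqP]; exact: Xu.
  by case=> -> u /negPf us; rewrite tnth_set_coord us.
rewrite measureU ?fineD ?fin_num_measure //.
apply/seteqP; split=> // w /= [-> e].
have : tnth (set_coord x s true) s = tnth (set_coord x s false) s by rewrite e.
by rewrite !tnth_set_coord eqxx.
Qed.

Lemma glauber_q_set_coord x s b :
  glauber_q X (set_coord x s b) s = glauber_q X x s.
Proof. by rewrite !glauber_q_mass !set_coordK. Qed.

(** Each single-site update preserves the law of [X] by [sum_resample], hence so does their average.
    Positive masses make the quotient in [glauber_q_mass] a genuine one. *)
Lemma glauber_op_stationary g : (0 < N)%N -> (forall x, 0 < mass X x) ->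
  \sum_x mass X x * glauber_op g x = \sum_x mass X x * g x.
Proof.
move=> N0 X0; under eq_bigr do rewrite glauber_opE mulr_sumr.
rewrite exchange_big /=.
under eq_bigr => s _.
  under eq_bigr do rewrite mulrCA.
  rewrite -mulr_sumr (@sum_resample _ _ s _ (fun x => glauber_q X x s)); first over.
  - by move=> x b; exact: glauber_q_set_coord.
  - by move=> x; rewrite glauber_q_mass divfK // gt_eqF // addr_gt0.
rewrite sumr_const card_ord -[(_ * _) *+ _]mulr_natl mulrA divff ?mul1r //.
by rewrite pnatr_eq0 -lt0n.
Qed.

Lemma glauber_op_contraction g (r : R) : 0 <= r ->
  (forall s x, coupling_within (glauber X (set_coord x s true))
                               (glauber X (set_coord x s false)) r) ->
  Delta_norm (glauber_op g) <= r * Delta_norm g.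
Proof.
move=> r0 cpl; apply: Delta_norm_le; first by rewrite mulr_ge0 // Delta_norm_ge0.
by move=> s x; exact: coupling_contraction.
Qed.

(** If [kappa^-1] were 0, all masses would vanish, while they sum to 1. *)
Lemma gibbs_const_neq0 (L : cube N -> R) kappa :
  has_law X (fun x => kappa^-1 * expR (L x)) -> kappa^-1 != 0.
Proof.
move=> XL; apply/eqP => k0; have := mass_sum1 X.
rewrite big1; first by move/esym/eqP; rewrite oner_eq0.
by move=> y _; rewrite (mass_law XL) k0 mul0r.
Qed.

Lemma glauber_q_gibbs (L : cube N -> R) kappa :
  has_law X (fun x => kappa^-1 * expR (L x)) ->
  forall x s, glauber_q X x s = (1 + expR (- Delta s L x))^-1.
Proof.
move=> XL x s; have mE := mass_law XL.
have k0 := gibbs_const_neq0 XL.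
rewrite glauber_q_mass !mE -mulrDr invfM mulrACA divff // mul1r.
rewrite /Delta opprB expRD expRN.
have := expR_gt0 (L (set_coord x s true)).
have := expR_gt0 (L (set_coord x s false)).
move: (expR _) (expR _) => v u v0 u0; field.
by rewrite !gt_eqF // addr_gt0.
Qed.

Lemma mass_gibbs_gt0 (L : cube N -> R) kappa :
  has_law X (fun x => kappa^-1 * expR (L x)) -> forall x, 0 < mass X x.
Proof.
move=> XL x; have mE := mass_law XL.
rewrite lt_neqAle mass_ge0 andbT eq_sym mE mulf_neq0 ?(gibbs_const_neq0 XL) //.
by rewrite gt_eqF // expR_gt0.
Qed.

End glauber_dynamics.

(** * Product form of the law of [Y] *)

Section independent.
Context d (T : measurableType d) (R : realType) (N : nat)
  (P : probability T R) (Y : {RV P >-> cube N}) (p : 'I_N -> R).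
Hypothesis Yind : independent_coords Y.
Hypothesis Yp : forall s, P [set w | tnth (Y w) s = true] = (p s)%:E.

Lemma mass_independent y :
  mass Y y = \prod_(s < N) (if tnth y s then p s else 1 - p s).
Proof.
rewrite /mass; have -> : Y @^-1` [set y] = [set w | forall s, s \in [set: 'I_N]%SET ->
    [set tnth y s] (tnth (Y w) s)].
  apply/seteqP; split=> w /=; first by move=> ->.
  by move=> h; apply: eq_from_tnth => s; apply: h; rewrite inE.
rewrite (Yind [set: 'I_N]%SET (fun s => [set tnth y s])).
rewrite (eq_bigr (fun s => (if tnth y s then p s else 1 - p s)%:E)); last first.
  move=> s _; case: (tnth y s); first exact: Yp.
  have -> : [set w | [set false] (tnth (Y w) s)] = ~` [set w | tnth (Y w) s = true].
    by apply/seteqP; split=> w /=; case: (tnth _ _).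
  by rewrite probability_setC ?Yp //; exact: (
    measurable_preimage_cube Y [set z | tnth z s = true]).
by rewrite prodEFin /=; apply: eq_bigl => s; rewrite inE.
Qed.

(** The two masses share the product over the other coordinates. This is the hypothesis of
    [sum_resample] with constant [q]. *)
Lemma mass_independent_coord y s :
  p s * (mass Y (set_coord y s true) + mass Y (set_coord y s false)) =
  mass Y (set_coord y s true).
Proof.
rewrite !mass_independent !(bigD1 (P := predT) s) //= !tnth_set_coord eqxx.
rewrite (eq_bigr (fun i => if tnth y i then p i else 1 - p i)); last first.
  by move=> i /negPf si; rewrite tnth_set_coord si.
rewrite [X in (1 - p s) * X](eq_bigr (fun i => if tnth y i then p i else 1 - p i)); last first.
  by move=> i /negPf si; rewrite tnth_set_coord si.
by ring.
Qed.

End independent.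

(** * One-step comparison and its iteration *)

Section stein.
Context d1 (T1 : measurableType d1) d2 (T2 : measurableType d2) (R : realType)
  (N : nat) (P : probability T1 R) (Q : probability T2 R)
  (X : {RV P >-> cube N}) (Y : {RV Q >-> cube N})
  (L : cube N -> R) (kappa : R) (p : 'I_N -> R).
Hypothesis XL : has_law X (fun x => kappa^-1 * expR (L x)).
Hypothesis Yind : independent_coords Y.
Hypothesis Yp : forall s, Q [set w | tnth (Y w) s = true] = (p s)%:E.
Hypothesis pfix : forall s : 'I_N,
  p s = (1 + tanh (2^-1 * mean Q (fun w => Delta s L (Y w)))) / 2.

(** How far the law of [Y] is from being stationary for the dynamics of [X]: the factor 1/4 is the
    logistic Lipschitz constant, 1/N the probability of choosing a site. *)
Lemma glauber_op_mean_field (g : cube N -> R) : (0 < N)%N ->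
  `|\sum_y mass Y y * glauber_op X g y - \sum_y mass Y y * g y| <=
  Delta_norm g * ((4 * N%:R)^-1 * \sum_(s < N) mean Q (fun w =>
    `| Delta s L (Y w) - mean Q (fun w' => Delta s L (Y w')) |)).
Proof.
move=> N0; have N1 : N%:R != 0 :> R by rewrite pnatr_eq0 -lt0n.
(* The mean of [g] under [Y] is rewritten as an average over resampled sites, to be compared with
   [glauber_opE] term by term. *)
have EY : \sum_y mass Y y * g y =
    \sum_(s < N) N%:R^-1 * \sum_y mass Y y *
      (p s * g (set_coord y s true) + (1 - p s) * g (set_coord y s false)).
  symmetry; under eq_bigr => s _.
    rewrite (@sum_resample _ _ s _ (fun=> p s)) //; first over.
    by move=> x; exact: mass_independent_coord.
  by rewrite sumr_const card_ord -[(_ * _) *+ _]mulr_natl mulrA divff ?mul1r.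
have -> : \sum_y mass Y y * glauber_op X g y - \sum_y mass Y y * g y =
    \sum_(s < N) N%:R^-1 * \sum_y mass Y y * ((glauber_q X y s - p s) * Delta s g y).
  rewrite EY; under eq_bigr do rewrite glauber_opE mulr_sumr.
  rewrite exchange_big -sumrB; apply: eq_bigr => s _ /=.
  under eq_bigr do rewrite mulrCA.
  rewrite -mulr_sumr -mulrBr -sumrB; congr (_ * _); apply: eq_bigr => y _.
  by rewrite /Delta; ring.
rewrite mulrA mulr_sumr (le_trans (ler_norm_sum _ _ _)) //.
apply: ler_sum => s _; rewrite (mean_mass Y (fun y => `|Delta s L y - _|)).
set m := mean Q _.
have -> : Delta_norm g / (4 * N%:R) * \sum_y mass Y y * `|Delta s L y - m| =
    N%:R^-1 * \sum_y mass Y y * (`|Delta s L y - m| / 4 * Delta_norm g).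
  by rewrite !mulr_sumr; apply: eq_bigr => y _; field.
rewrite normrM (ger0_norm (x := N%:R^-1)) ?invr_ge0 // ler_wpM2l ?invr_ge0 //.
rewrite (le_trans (ler_norm_sum _ _ _)) //; apply: ler_sum => y _.
rewrite normrM (ger0_norm (mass_ge0 _ _)) ler_wpM2l ?mass_ge0 // normrM.
rewrite ler_pM // ?Delta_le_norm // (glauber_q_gibbs XL) pfix tanh_half.
exact: logistic_lipschitz.
Qed.

Lemma mean_field_iterate (rho : R) (h : cube N -> R) n : (0 < N)%N -> 0 < rho <= 1 ->
  (forall s x, coupling_within (glauber X (set_coord x s true))
                               (glauber X (set_coord x s false)) (1 - rho)) ->
  `|\sum_x mass X x * h x - \sum_y mass Y y * h y| <=
  (N%:R * (1 - rho) ^+ n + (4 * N%:R * rho)^-1 * \sum_(s < N) mean Q (fun w =>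
    `| Delta s L (Y w) - mean Q (fun w' => Delta s L (Y w')) |)) * Delta_norm h.
Proof.
move=> N0 /andP[rho0 rho1] cpl.
have rho'0 : 0 <= 1 - rho by rewrite subr_ge0.
set S := \sum_(s < N) _.
have S0 : 0 <= S.
  apply: sumr_ge0 => s _; rewrite (mean_mass Y (fun y => `|Delta s L y - _|)).
  by apply: sumr_ge0 => y _; rewrite mulr_ge0 // mass_ge0.
elim: n h => [|n IH] h.
  (* Base case: under the product of the two laws, [h x - h y] is at most [Delta_norm h] times the
     diameter N of the cube. *)
  rewrite expr0 mulr1.
  have -> : \sum_x mass X x * h x - \sum_y mass Y y * h y =
      \sum_x \sum_y mass X x * mass Y y * (h x - h y).
    under [RHS]eq_bigr => x _.
      under eq_bigr do rewrite mulrBr.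
      rewrite sumrB -mulr_suml -mulr_sumr mass_sum1 mulr1.
      under [X in _ - X]eq_bigr do rewrite -mulrA.
      rewrite -mulr_sumr; over.
    by rewrite sumrB -mulr_suml mass_sum1 mul1r.
  apply: (@le_trans _ _ (\sum_x \sum_y mass X x * mass Y y * (N%:R * Delta_norm h))).
    rewrite (le_trans (ler_norm_sum _ _ _)) //; apply: ler_sum => x _.
    rewrite (le_trans (ler_norm_sum _ _ _)) //; apply: ler_sum => y _.
    have m0 : 0 <= mass X x * mass Y y by rewrite mulr_ge0 // mass_ge0.
    rewrite normrM (ger0_norm m0) ler_wpM2l // mulrC.
    rewrite (le_trans (hamming_lipschitz h x y)) //.
    by rewrite ler_wpM2l ?Delta_norm_ge0 // hamming_le.
  under eq_bigr do rewrite -mulr_suml -mulr_sumr mass_sum1 mulr1.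
  rewrite -mulr_suml mass_sum1 mul1r ler_wpM2r ?Delta_norm_ge0 // lerDl.
  by rewrite mulr_ge0 // invr_ge0 !mulr_ge0 // ltW.
pose h' := glauber_op X h.
(* Stationarity replaces [h] by [h'] under [X]; the triangle inequality through the mean of [h']
   under [Y] then leaves the induction hypothesis at [h'] and the one-step error. *)
rewrite -(glauber_op_stationary h N0 (mass_gibbs_gt0 XL)) -/h'.
apply: (le_trans (ler_distD (\sum_y mass Y y * h' y) _ _)).
apply: (le_trans (lerD (IH h') (glauber_op_mean_field h N0))); rewrite -/S.
have := glauber_op_contraction h rho'0 cpl; rewrite -/h' => ct.
set c := (X in X * Delta_norm h').
have c0 : 0 <= c.
  by rewrite addr_ge0 // mulr_ge0 ?exprn_ge0 // invr_ge0 !mulr_ge0 // ltW.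
have /le_trans -> // := lerD (ler_wpM2l c0 ct) (lexx (Delta_norm h * ((4 * N%:R)^-1 * S))).
(* Equality holds, since (1 - rho) / (4 N rho) + 1 / (4 N) = 1 / (4 N rho). *)
rewrite le_eqVlt; apply/orP; left; apply/eqP.
rewrite /c exprS; field.
by rewrite gt_eqF //= pnatr_eq0 -lt0n.
Qed.

End stein.

(** * Passage to the limit in the number of steps *)

Theorem theorem1p1 (R : realType) (N : nat) (HN : (0 < N)%N)
  (d1 : measure_display) (T1 : measurableType d1) (P : probability T1 R)
  (d2 : measure_display) (T2 : measurableType d2) (Q : probability T2 R)
  (X : {RV P >-> cube N}) (Y : {RV Q >-> cube N})
  (L : cube N -> R) (kappa : R) (p : 'I_N -> R) (rho : R)
  (HX : has_law X (fun x => kappa^-1 * expR (L x)))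
  (HYind : independent_coords Y)
  (Hp : forall s : 'I_N, Q [set w | tnth (Y w) s = true] = (p s)%:E)
  (Hpfix : forall s : 'I_N,
     p s = (1 + tanh (2^-1 * mean Q (fun w => Delta s L (Y w)))) / 2)
  (Hrho : 0 < rho <= 1)
  (Hcoupling : forall (s : 'I_N) (x : cube N),
     coupling_within (glauber X (set_coord x s true))
                     (glauber X (set_coord x s false)) (1 - rho))
  (Hirr : irreducible_chain (glauber X))
  (h : cube N -> R) :
  `| mean P (fun w => h (X w)) - mean Q (fun w => h (Y w)) | <=
  Delta_norm h / (4 * N%:R * rho) *
  \sum_(s < N) mean Q (fun w =>
    `| Delta s L (Y w) - mean Q (fun w' => Delta s L (Y w')) |).
Proof.
rewrite !mean_mass.
have bound n := mean_field_iterate HX HYind Hp Hpfix h n HN Hrho Hcoupling.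
move: Hrho bound => /andP[rho0 rho1].
set S := \sum_(s < N) _; set D := `| _ - _ | => bound.
(* The bound on [D] holds for every [n], hence also in the limit, where (1 - rho)^n vanishes because
   0 <= 1 - rho < 1. *)
suff : (fun n => (N%:R * (1 - rho) ^+ n + (4 * N%:R * rho)^-1 * S) * Delta_norm h)
    @ \oo --> (N%:R * 0 + (4 * N%:R * rho)^-1 * S) * Delta_norm h.
  move=> cv; have -> : Delta_norm h / (4 * N%:R * rho) * S =
      (N%:R * 0 + (4 * N%:R * rho)^-1 * S) * Delta_norm h.
    by rewrite mulr0 add0r mulrC mulrA mulrC mulrA.
  rewrite -(cvg_lim _ cv) //; apply: limr_ge; first by apply/cvg_ex; eexists; exact: cv.
  by apply: nearW.
apply: cvgMl; apply: cvgD; last exact: cvg_cst.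
apply: cvgMr; apply: cvg_expr.
by rewrite ger0_norm ?subr_ge0 // gtrBl.
Qed.
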